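(* Let $q=p^k$ where $p$ is a prime and $k\ge 1$, and let $m$ be a positive integer with $m\mid q-1$. Let $N(m)$ be the number of conjugacy classes (under conjugation in $\mathrm{GL}(2,q)$) of reducible cyclic subgroups of $\mathrm{GL}(2,q)$ of order $m$. Write the prime decomposition $m=2^{\beta_0}p_1^{\beta_1}\cdots p_r^{\beta_r}$, where $p_1,\dots,p_r$ are distinct odd primes, $\beta_i\ge 1$ for $1\le i\le r$, and $\beta_0\ge 0$. Then $$N(m)=\tfrac12\big(\rho(m)+\delta(m)\big),$$ where $\rho(m)=\prod_{i=0}^{r}\big(p_i^{\beta_i}+p_i^{\beta_i-1}\big)$ with $p_0=2$ if $\beta_0\ge 1$, and $\rho(m)=\prod_{i=1}^{r}\big(p_i^{\beta_i}+p_i^{\beta_i-1}\big)$ if $m$ is odd (empty product $=1$), and $$\delta(m)=\begin{cases}2^{r} & \text{if } 0\le\beta_0\le 1,\\ 2^{r+1} & \text{if } \beta_0=2,\\ 2^{r+2} & \text{if } \beta_0\ge 3.\end{cases}$$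
   Context: A subgroup $H\le \mathrm{GL}(2,q)$ is reducible if the natural module $\mathbb{F}_q^2$ has an $H$-invariant subspace of dimension $1$. $\mathbb{F}_q$ denotes the finite field with $q$ elements. *)

(* Defs.v *)
From HB Require Import structures.
From mathcomp Require Import all_boot all_order all_algebra all_fingroup all_solvable all_field.
Set Implicit Arguments. Unset Strict Implicit. Unset Printing Implicit Defensive.
Import GRing.Theory.
Local Open Scope ring_scope.
Local Open Scope group_scope.

Definition reducibleGL (F : finFieldType) (H : {set {'GL_2[F]}}) : bool :=
  [exists v : 'rV[F]_2, (\rank v == 1%N) &&
    [forall g in H, (v *m GLval g <= v)%MS]].

Definition red_cyc_subgroups (F : finFieldType) (m : nat)
  : {set {set {'GL_2[F]}}} :=
  [set H : {set {'GL_2[F]}} | [&& group_set H, cyclic H, #|H| == m &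
     reducibleGL H]].

Definition Ncl (F : finFieldType) (m : nat) : nat :=
  #|[set (H :^: [set: {'GL_2[F]}]) | H in red_cyc_subgroups F m]|.

Definition rho (m : nat) : nat :=
  \prod_(p <- primes m) (p ^ logn p m + p ^ (logn p m).-1)%N.

Definition delta (m : nat) : nat :=
  let r := count odd (primes m) in
  let b0 := logn 2 m in
  if (b0 <= 1)%N then (2 ^ r)%N
  else if b0 == 2%N then (2 ^ r.+1)%N else (2 ^ r.+2)%N.

(* Main.v *)
Require Import Defs.
From mathcomp Require Import all_boot all_order all_algebra all_fingroup all_solvable all_field.
From mathcomp Require Import zify ring.

(* An element of order m dividing q - 1 is annihilated by the split separable polynomial X^q - X,
   hence diagonalizable over F; so every cyclic subgroup of order m is conjugate to one generated
   by a diagonal matrix, and two such subgroups <diag x>, <diag y> are conjugate iff <x> = <y> or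
   <x> = <swap y> in A * A, where A is the cyclic group of units of F. Weighting each x of order m
   in A * A by 1, or by 2 if <x> is stable under the swap, every class gets total weight
   2 phi(m). Hence 2 phi(m) N(m) is the number of elements of order m plus the number of those
   generating a swap-stable subgroup. Both numbers are multiplicative in m, the former being
   phi(p^e) (p^e + p^(e-1)) at prime powers; the latter is phi(m) times the number of square roots
   of 1 modulo m. *)

Set Implicit Arguments.
Unset Strict Implicit.
Unset Printing Implicit Defensive.

(** * Elements of given order in abelian groups, and pairs of elements of a cyclic group *)

Section Counting.

Local Open Scope group_scope.

(** One definition serves both counts: the identity as [f] gives all elements of order [n], and
    [swap] gives those generating a swap-stable subgroup. *)
Definition stable_elts (gT : finGroupType) (f : gT -> gT) (n : nat) : {set gT} :=
  [set x | (#[x] == n) && (f x \in <[x]>)].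

Lemma stable_elts1 (gT : finGroupType) (f : gT -> gT) :
  f 1 = 1 -> #|stable_elts f 1%N| = 1%N.
Proof.
move=> f1; rewrite -[RHS](cards1 (1 : gT)); congr #|pred_of_set _|.
apply/setP=> x; rewrite !inE order_eq1.
by case: eqP => // ->; rewrite f1 group1.
Qed.

(** The exponents [u] and [v] from the Chinese remainder theorem split an element of order [m * n]
    uniquely into factors of orders [m] and [n]. These factors are powers of the element and [f]
    commutes with powers, so the product is stable iff both factors are. *)
Lemma card_stable_eltsM (gT : finGroupType) (f : gT -> gT) (m n : nat) :
    abelian [set: gT] -> {morph f : x y / x * y} ->
    (0 < m)%N -> (0 < n)%N -> coprime m n ->
  #|stable_elts f (m * n)| = (#|stable_elts f m| * #|stable_elts f n|)%N.
Proof.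
move=> abG fM m_gt0 n_gt0 co_mn.
have comm (x y : gT) : commute x y by apply: (centsP abG); rewrite inE.
have fX x k : f (x ^+ k) = f x ^+ k.
  elim: k => [|k IHk]; last by rewrite !expgS fM IHk.
  by apply: (mulgI (f 1)); rewrite !expg0 -fM !mulg1.
have powE k l (x : gT) : k = l %[mod #[x]] -> x ^+ k = x ^+ l.
  by move/eqP; rewrite -eq_expg_mod_order => /eqP.
pose u := chinese m n 1 0; pose v := chinese m n 0 1.
have um : u = 1 %[mod m] by exact: chinese_modl.
have un : u = 0 %[mod n] by exact: chinese_modr.
have vm : v = 0 %[mod m] by exact: chinese_modl.
have vn : v = 1 %[mod n] by exact: chinese_modr.
have mulu (y z : gT) : #[y] = m -> #[z] = n -> (y * z) ^+ u = y.
  move=> ym zn; rewrite expgMn; last exact: comm.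
  by rewrite (powE u 1%N y) ?ym // (powE u 0%N z) ?zn // expg1 mulg1.
have mulv (y z : gT) : #[y] = m -> #[z] = n -> (y * z) ^+ v = z.
  move=> ym zn; rewrite expgMn; last exact: comm.
  by rewrite (powE v 0%N y) ?ym // (powE v 1%N z) ?zn // expg1 mul1g.
rewrite -cardsX -(@card_in_imset _ _ (fun p => p.1 * p.2)); last first.
  move=> [y z] [y' z']; rewrite !inE /= -!andbA.
  case/and4P=> /eqP ym _ /eqP zn _ /and4P[/eqP y'm _ /eqP z'n _] E.
  by rewrite -(mulu y z) // -{2}(mulv y z) // E mulu // mulv.
congr #|pred_of_set _|; apply/setP=> x; apply/idP/imsetP; last first.
  case=> [[y z]]; rewrite !inE /= => /andP[/andP[/eqP ym fy] /andP[/eqP zn fz]] ->.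
  have yz : #[y * z] = (m * n)%N by rewrite orderM ?ym ?zn //; apply: comm.
  rewrite yz eqxx fM groupM //.
    by apply: subsetP fy; rewrite cycle_subG -{1}(mulu y z) // mem_cycle.
  by apply: subsetP fz; rewrite cycle_subG -{1}(mulv y z) // mem_cycle.
rewrite inE => /andP[/eqP xmn /cycleP[k fx]].
have xuv : x = x ^+ u * x ^+ v.
  rewrite -expgD -{1}(expg1 x); apply: powE; rewrite xmn.
  apply/eqP; rewrite chinese_remainder //; apply/andP; split; apply/eqP.
    by rewrite -modnDm um vm modnDm.
  by rewrite -modnDm un vn modnDm.
have ox a b c : (#[x] = b * c)%N -> coprime b c -> a = 1 %[mod b] -> a = 0 %[mod c] ->
    #[x ^+ a] = b.
  move=> xbc co_bc ab ac.
  have c_gt0 : (0 < c)%N.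
    by move: (order_gt0 x); rewrite xbc muln_gt0 => /andP[].
  have co_ab : coprime b a by rewrite -coprime_modr ab coprime_modr coprimen1.
  have c_a : (c %| a)%N by apply/eqP; rewrite ac mod0n.
  (* As [c] divides [a] and [a] is prime to [b], the gcd of [b * c] and [a] is [c]. *)
  rewrite orderXgcd xbc -{1}(divnK c_a) -muln_gcdl.
  suff -> : gcdn b (a %/ c) = 1%N by rewrite mul1n mulnK.
  by apply/eqP; apply: coprime_dvdr co_ab; rewrite -{2}(divnK c_a) dvdn_mulr.
exists (x ^+ u, x ^+ v) => //.
have fXu a : f (x ^+ a) \in <[x ^+ a]> by rewrite fX fx -expgM mulnC expgM mem_cycle.
by rewrite !inE /= !fXu !andbT (ox u m n) // (ox v n m) ?eqxx // 1?mulnC // coprime_sym.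
Qed.

Lemma order_expg_div (gT : finGroupType) (g : gT) (d : nat) :
  (d %| #[g])%N -> #[g ^+ (#[g] %/ d)] = d.
Proof.
move=> dvd_d; rewrite orderXdiv ?dvdn_div // -{1}(divnK dvd_d) mulKn //.
by rewrite divn_gt0 ?(dvdn_gt0 _ dvd_d) // dvdn_leq.
Qed.

(** For a generator [g], the solutions form the subgroup generated by [g ^+ (#[g] %/ d)], which has
    order [d]. *)
Lemma card_expg_eq1 (uT : finGroupType) (d : nat) :
  cyclic [set: uT] -> (d %| #|[set: uT]|)%N -> #|[set x : uT | x ^+ d == 1]| = d.
Proof.
case/cyclicP=> g Gg; rewrite Gg -orderE => dvd_d.
have oc := order_expg_div dvd_d.
rewrite -[RHS]oc orderE; congr #|pred_of_set _|; apply/setP=> x; rewrite inE -order_dvdn.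
apply/idP/idP=> [xd|/order_dvdG]; last by rewrite -orderE oc.
have/cycleP[k xk] : x \in <[g]> by rewrite -Gg inE.
move: xd; rewrite xk order_dvdn -expgM -order_dvdn -{1}(divnK dvd_d).
rewrite dvdn_pmul2r ?(dvdn_gt0 _ dvd_d) // => /dvdnP[l ->].
by rewrite mulnC expgM mem_cycle.
Qed.

(** A cyclic group has a single subgroup of order [d], and the elements of order [d] are its
    generators. *)
Lemma card_order_eq (uT : finGroupType) (d : nat) :
  cyclic [set: uT] -> (d %| #|[set: uT]|)%N -> #|[set x : uT | #[x] == d]| = totient d.
Proof.
move=> cycG dvd_d; have [g Gg] := cyclicP cycG.
have dvd_g : (d %| #[g])%N by rewrite orderE -Gg.
rewrite -{2}(order_expg_div dvd_g) totient_gen; congr #|pred_of_set _|.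
apply/setP=> x; rewrite !inE /generator.
by rewrite (eq_subG_cyclic cycG) ?subsetT // -!orderE (order_expg_div dvd_g) eq_sym.
Qed.

Lemma expg_pair (aT bT : finGroupType) (a : aT) (b : bT) (k : nat) :
  (a, b) ^+ k = (a ^+ k, b ^+ k).
Proof. by elim: k => // k IHk; rewrite !expgS IHk. Qed.

Definition swap (T : Type) (x : T * T) : T * T := (x.2, x.1).

Lemma swapX (gT : finGroupType) (x : gT * gT) (k : nat) : swap x ^+ k = swap (x ^+ k).
Proof. by case: x => a b; rewrite /swap !expg_pair. Qed.

Lemma cycle_swap (gT : finGroupType) (x : gT * gT) : <[swap x]> = @swap gT @: <[x]>.
Proof.
apply/setP=> y; apply/cycleP/imsetP=> [[k ->]|[_ /cycleP[k ->] ->]].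
  by exists (x ^+ k); rewrite ?mem_cycle ?swapX.
by exists k; rewrite swapX.
Qed.

Lemma order_swap (gT : finGroupType) (x : gT * gT) : #[swap x] = #[x].
Proof. by rewrite orderE cycle_swap card_imset // => -[a b] [c d] [-> ->]. Qed.

Lemma mem_swap_cycle (gT : finGroupType) (x : gT * gT) : (swap x \in <[x]>) = (<[swap x]> == <[x]>).
Proof.
by rewrite -cycle_subG eqEcard -!orderE order_swap leqnn andbT.
Qed.

Lemma card_pair_expg_eq1 (uT : finGroupType) (d : nat) :
    cyclic [set: uT] -> (d %| #|[set: uT]|)%N ->
  #|[set x : uT * uT | x ^+ d == 1]| = (d * d)%N.
Proof.
move=> cycG dvd_d; rewrite -{2 3}(card_expg_eq1 cycG dvd_d) -cardsX.
by congr #|pred_of_set _|; apply/setP=> -[a b]; rewrite !inE expg_pair.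
Qed.

(** These pairs are killed by [p ^ e.+1] but not by [p ^ e], so they number p^(2e+2) - p^(2e), which
    factors as stated. *)
Lemma card_pair_order_pfactor (uT : finGroupType) (p e : nat) :
    cyclic [set: uT] -> prime p -> (p ^ e.+1 %| #|[set: uT]|)%N ->
  #|[set x : uT * uT | #[x] == (p ^ e.+1)%N]|
    = (totient (p ^ e.+1) * (p ^ e.+1 + p ^ e))%N.
Proof.
move=> cycG p_pr dvd_p.
have dvd_p' : (p ^ e %| #|[set: uT]|)%N by apply: dvdn_trans dvd_p; rewrite dvdn_exp2l.
have sub : [set x : uT * uT | x ^+ (p ^ e) == 1] \subset [set x | x ^+ (p ^ e.+1) == 1].
  apply/subsetP=> x; rewrite !inE -!order_dvdn => /dvdn_trans; apply.
  by rewrite dvdn_exp2l.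
transitivity #|[set x : uT * uT | x ^+ (p ^ e.+1) == 1] :\: [set x | x ^+ (p ^ e) == 1]|.
  congr #|pred_of_set _|; apply/setP=> x; rewrite !inE -!order_dvdn.
  apply/eqP/andP=> [->|[nx /(dvdn_pfactor _ _ p_pr)[f fe xf]]].
    by rewrite dvdnn dvdn_Pexp2l ?prime_gt1 // ltnn.
  move: nx; rewrite xf dvdn_Pexp2l ?prime_gt1 // -ltnNge => ef.
  by congr (p ^ _)%N; apply/eqP; rewrite eqn_leq fe.
rewrite cardsD (setIidPr sub) !card_pair_expg_eq1 // totient_pfactor //=.
by case: p p_pr {dvd_p dvd_p' sub} => // p _; rewrite expnS /=; nia.
Qed.

Definition sqrt1_mod (m : nat) : {set 'I_m} := [set k : 'I_m | k * k == 1 %[mod m]].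

(** If [(b, a)] is the [k]-th power of [(a, b)], then [b = a ^+ k] and [a = b ^+ k], so [a] has
    order [m] and [k * k] is 1 modulo [m]. Hence [(a, k)] parametrizes the stable pairs as
    [(a, a ^+ k)]. *)
Lemma card_stable_swap (uT : finGroupType) (m : nat) :
    cyclic [set: uT] -> (0 < m)%N -> (m %| #|[set: uT]|)%N ->
  #|stable_elts (@swap uT) m| = (totient m * #|sqrt1_mod m|)%N.
Proof.
move=> cycG m_gt0 dvd_m; rewrite -(card_order_eq cycG dvd_m) -cardsX.
rewrite -(@card_in_imset _ _ (fun p : uT * 'I_m => (p.1, p.1 ^+ p.2))); last first.
  move=> [a k] [a' k']; rewrite !inE /= => /andP[/eqP am _] /andP[_ _] [<- /eqP].
  by rewrite eq_expg_mod_order am !modn_small // => /eqP/val_inj->.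
congr #|pred_of_set _|; apply/setP=> -[a b]; apply/idP/imsetP.
  rewrite inE /= => /andP[/eqP xm /cycleP[k]]; rewrite expg_pair => -[bk ak].
  have dvd_ab n : (#[(a, b)] %| n)%N = (#[a] %| n)%N.
    rewrite !order_dvdn expg_pair; apply/eqP/eqP=> [[->] //|an].
    by rewrite an bk -expgM mulnC expgM an expg1n.
  have am : #[a] = m.
    by apply/eqP; rewrite eqn_dvd -dvd_ab xm dvdnn -xm dvd_ab dvdnn.
  exists (a, Ordinal (ltn_pmod k m_gt0)); last first.
    by rewrite /= -am expg_mod_order -bk.
  rewrite !inE /= am eqxx modnMm -am -eq_expg_mod_order expgM -bk -ak.
  by rewrite expg1 eqxx.
case=> -[a' k]; rewrite !inE /= => /andP[/eqP am kk] [-> ->].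
have a'k : a' ^+ k ^+ k = a'.
  by apply/eqP; rewrite -expgM -[X in _ == X]expg1 eq_expg_mod_order am.
apply/andP; split; last first.
  by apply/cycleP; exists k; rewrite expg_pair a'k.
have a'm : a' ^+ m = 1 by rewrite -am expg_order.
rewrite eqn_dvd order_dvdn expg_pair -expgM mulnC expgM a'm expg1n eqxx /=.
rewrite -[X in (X %| _)%N]am order_dvdn.
by have := expg_order (a', a' ^+ k); rewrite expg_pair => -[-> _].
Qed.

Lemma conj_classJ (gT : finGroupType) (H : {set gT}) (g : gT) :
  (H :^ g) :^: [set: gT] = H :^: [set: gT].
Proof.
apply/setP=> K; apply/imsetP/imsetP=> -[k _ ->].
  by exists (g * k); rewrite ?inE // conjsgM.
by exists (g^-1 * k); rewrite ?inE // -conjsgM mulKVg.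
Qed.

End Counting.

(** * Multiplicative functions, and square roots of 1 modulo prime powers *)

Lemma multiplicative_prod_primes (f : nat -> nat) (m : nat) :
    f 1 = 1 -> (0 < m)%N ->
    (forall a b, (0 < a)%N -> (0 < b)%N -> (a * b %| m)%N -> coprime a b ->
       f (a * b)%N = (f a * f b)%N) ->
  f m = \prod_(p <- primes m) f (p ^ logn p m)%N.
Proof.
move=> f1 m_gt0 fM; have Em := prod_prime_decomp m_gt0.
rewrite prime_decompE big_map /= in Em.
(* Replacing [primes m] by any duplicate-free list of primes whose product of prime powers divides
   [m] makes induction on the list possible. *)
suff: forall s : seq nat, uniq s -> all prime s -> (\prod_(p <- s) p ^ logn p m %| m)%N ->
    f (\prod_(p <- s) p ^ logn p m)%N = \prod_(p <- s) f (p ^ logn p m)%N.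
  move=> <-; rewrite -?Em ?primes_uniq //.
  by apply/allP=> p; rewrite mem_primes => /andP[].
elim=> [|p s IHs]; first by rewrite !big_nil.
rewrite /= !big_cons => /andP[ps us] /andP[p_pr s_pr] dvd_ps.
rewrite fM ?expn_gt0 ?(prime_gt0 p_pr) //.
- by rewrite IHs // (dvdn_trans _ dvd_ps) ?dvdn_mull.
- by rewrite big_seq prodn_cond_gt0.
rewrite coprimeXl // big_seq.
apply: (big_ind (coprime p)) => [|a b pa pb|q qs]; first exact: coprimen1.
  by rewrite coprimeMr pa.
rewrite coprimeXr // prime_coprime // dvdn_prime2 //; last exact: (allP s_pr).
by apply: contraNneq ps => ->.
Qed.

(** An odd prime cannot divide both [k - 1] and [k + 1], so the whole prime power divides one of
    them, and [k] is 1 or -1 modulo it. *)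
Lemma card_sqrt1_mod_odd (p e : nat) :
  prime p -> odd p -> #|sqrt1_mod (p ^ e.+1)| = 2.
Proof.
move=> p_pr p_odd; set m := (p ^ e.+1)%N.
have m_odd : odd m by rewrite oddX p_odd orbT.
have p_gt2 : (2 < p)%N by case: p p_pr p_odd {m m_odd} => [|[|[]]].
have m_gt2 : (2 < m)%N.
  by apply: leq_trans p_gt2 _; rewrite -{1}(expn1 p) leq_exp2l ?prime_gt1.
have lt1 : (1 < m)%N by lia.
have ltm1 : (m.-1 < m)%N by lia.
suff -> : sqrt1_mod m = [set Ordinal lt1; Ordinal ltm1].
  by rewrite cards2 -val_eqE /=; case: eqP => //; lia.
apply/setP=> k; rewrite !inE -!val_eqE /=.
case: k => k /= lt_km; apply/idP/orP; last first.
  case=> /eqP->; first by rewrite mul1n.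
  rewrite eqn_mod_dvd; last by nia.
  by apply/dvdnP; exists (m - 2); nia.
case: (posnP k) => [->|k_gt0]; first by rewrite mod0n modn_small.
rewrite eqn_mod_dvd ?muln_gt0 ?k_gt0 // -(exp1n 2) mulnn subn_sqr.
case: (boolP (p %| k - 1)) => pk1 dvd_m.
  have cop : coprime m (k + 1).
    rewrite coprimeXl // prime_coprime //; apply: contraTN pk1 => pk1.
    apply: contraTN p_gt2 => pk1'; rewrite -leqNgt dvdn_leq //.
    have -> : 2 = (k + 1) - (k - 1) by lia.
    exact: dvdn_sub.
  rewrite Gauss_dvdl // in dvd_m; left; case: (posnP (k - 1)) => [|k1_gt0]; first by lia.
  by have := dvdn_leq k1_gt0 dvd_m; lia.
have cop : coprime m (k - 1) by rewrite coprimeXl // prime_coprime.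
rewrite Gauss_dvdr // in dvd_m; right; apply/eqP.
by have := dvdn_leq _ dvd_m; lia.
Qed.

Lemma card_sqrt1_mod_pow2 (e : nat) :
  #|sqrt1_mod (2 ^ e.+3)| = 4.
Proof.
set n := (2 ^ e.+1)%N; have n_gt1 : (1 < n)%N by rewrite -{1}(expn0 2) ltn_exp2l.
have n_ev : ~~ odd n by rewrite oddX.
have -> : (2 ^ e.+3 = 4 * n)%N by rewrite /n !expnS; lia.
have lt1 : (1 < 4 * n)%N by lia.
have lt2 : ((2 * n).-1 < 4 * n)%N by lia.
have lt3 : ((2 * n).+1 < 4 * n)%N by lia.
have lt4 : ((4 * n).-1 < 4 * n)%N by lia.
suff -> : sqrt1_mod (4 * n) = [set x in [:: Ordinal lt1; Ordinal lt2; Ordinal lt3; Ordinal lt4]].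
  by rewrite cardsE (card_uniqP _) //= !inE -!val_eqE /=; lia.
apply/setP=> k; rewrite !inE -!val_eqE /=.
case: k => k /= lt_k; apply/idP/idP; last first.
  (* Each witness is the quotient of k^2 - 1 by [4 * n], for [k] equal to 1, 2n - 1, 2n + 1 and 4n -
     1 in turn. *)
  case/or4P=> /eqP->; rewrite eqn_mod_dvd; try nia; apply/dvdnP.
  - by exists 0.
  - by exists (n - 1); nia.
  - by exists (n + 1); nia.
  - by exists (4 * n - 2); nia.
case: (posnP k) => [->|k_gt0]; first by rewrite mod0n modn_small.
rewrite eqn_mod_dvd ?muln_gt0 ?k_gt0 // -(exp1n 2) mulnn subn_sqr => dvd_k.
have k_odd : odd k.
  have : (2 %| (k - 1) * (k + 1))%N.
    by apply: dvdn_trans dvd_k; rewrite dvdn_mulr.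
  by rewrite dvdn2 oddM oddD oddB //= addbT; case: odd.
(* With k = 2h + 1, k^2 - 1 = 4 h (h + 1), and n is coprime to the odd one of h and h + 1. *)
have [h kh] : exists h, k = h.*2.+1 by exists k./2; rewrite -[LHS]odd_double_half k_odd.
move: dvd_k; rewrite {}kh in lt_k *.
have -> : ((h.*2.+1 - 1) * (h.*2.+1 + 1) = 4 * (h * h.+1))%N.
  by rewrite subn1 addn1 -doubleS -!muln2 mulnACA mulnC.
rewrite dvdn_pmul2l //.
(* Since [h < 2 * n], an odd [h] forces [h.+1] to be n or 2n, and an even [h] is 0 or n; these give
   the four listed values of [k]. *)
have [h_odd|h_ev] := boolP (odd h).
  rewrite Gauss_dvdr ?coprimeXl ?coprime2n // => /dvdnP[[|[|[|q]]]]; nia.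
rewrite Gauss_dvdl ?coprimeXl ?coprime2n //= => /dvdnP[[|[|[|q]]]]; nia.
Qed.

Lemma card_sqrt1_mod2 : #|sqrt1_mod 2| = 1%N.
Proof.
rewrite -[RHS](cards1 (Ordinal (isT : 1 < 2))); congr #|pred_of_set _|.
by apply/setP=> -[[|[|k]] lt_k]; rewrite !inE -?val_eqE.
Qed.

Lemma card_sqrt1_mod4 : #|sqrt1_mod 4| = 2.
Proof.
pose o1 := Ordinal (isT : 1 < 4); pose o3 := Ordinal (isT : 3 < 4).
have -> : sqrt1_mod 4 = [set o1; o3].
  by apply/setP=> -[[|[|[|[|k]]]] lt_k]; rewrite !inE -?val_eqE.
by rewrite cards2.
Qed.

Lemma logn_primesS (m p : nat) : p \in primes m -> exists2 e, logn p m = e.+1 & prime p.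
Proof.
rewrite -logn_gt0 => lp; exists (logn p m).-1; rewrite ?prednK //.
by rewrite logn_gt0 mem_primes in lp; case/andP: lp.
Qed.

(** Each odd prime contributes 2 roots, while the prime 2 contributes 1, 2 or 4 according as its
    exponent is 1, 2 or at least 3. *)
Lemma delta_prod (m : nat) :
  (0 < m)%N -> delta m = \prod_(p <- primes m) #|sqrt1_mod (p ^ logn p m)|.
Proof.
move=> m_gt0; rewrite (bigID odd) /= mulnC.
have -> : (\prod_(p <- primes m | odd p) #|sqrt1_mod (p ^ logn p m)|)%N
          = (2 ^ count odd (primes m))%N.
  rewrite -big_filter -size_filter.
  rewrite (eq_big_seq (fun=> 2)) ?big_const_seq ?count_predT ?iter_muln ?muln1 //.
  move=> p; rewrite mem_filter => /andP[p_odd /logn_primesS[e -> p_pr]].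
  exact: card_sqrt1_mod_odd.
have -> : (\prod_(p <- primes m | ~~ odd p) #|sqrt1_mod (p ^ logn p m)|)%N
          = if logn 2 m is 0 then 1 else #|sqrt1_mod (2 ^ logn 2 m)|.
  rewrite big_mkcond /=; case E: (logn 2 m) => [|e].
    rewrite big1_seq //= => p pm; case: ifP => // p_ev.
    have [f fE p_pr] := logn_primesS pm.
    by move: fE; rewrite (prime_oddPn p_pr p_ev) E.
  have m2 : 2 \in primes m by rewrite -logn_gt0 E.
  rewrite (big_rem _ m2) /= E big1_seq ?muln1 // => p.
  rewrite /= mem_rem_uniq ?primes_uniq // inE => /andP[/= p2 /logn_primesS[f _ p_pr]].
  by case: (boolP (odd p)) => // p_ev; case/eqP: p2; apply: prime_oddPn.
rewrite /delta; case: logn => [|[|[|e]]] /=; rewrite ?card_sqrt1_mod2 ?mul1n //.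
  by rewrite card_sqrt1_mod4 expnS.
by rewrite card_sqrt1_mod_pow2 !expnS mulnA.
Qed.

(** * Both element counts for the square of a cyclic group, assembled from prime powers *)

Section CyclicSquare.

Local Open Scope group_scope.

Variables (uT : finGroupType) (m : nat).
Hypotheses (cycU : cyclic [set: uT]) (m_gt0 : (0 < m)%N) (dvd_m : (m %| #|[set: uT]|)%N).

Let dvd_pf p : (p ^ logn p m %| #|[set: uT]|)%N.
Proof. exact: dvdn_trans (pfactor_dvdnn p m) dvd_m. Qed.

Let totient_prod : totient m = (\prod_(p <- primes m) totient (p ^ logn p m))%N.
Proof. by apply: multiplicative_prod_primes => // a b _ _ _; apply: totient_coprime. Qed.

Let abelian_square : abelian [set: (uT * uT)%type].
Proof.
apply/centsP=> -[a b] _ [c d] _.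
by congr pair; apply: (centsP (cyclic_abelian cycU)); rewrite inE.
Qed.

Lemma card_pair_order : #|[set x : uT * uT | #[x] == m]| = (totient m * rho m)%N.
Proof.
have stable_id n : #|[set x : uT * uT | #[x] == n]| = #|stable_elts (@id (uT * uT)) n|.
  by apply: eq_card => x; rewrite !inE cycle_id andbT.
rewrite stable_id.
rewrite (@multiplicative_prod_primes (fun n => #|stable_elts (@id (uT * uT)) n|)) //=.
- rewrite totient_prod /rho -big_split /=; apply: eq_big_seq => p pm.
  rewrite -stable_id; have := dvd_pf p; have [e -> p_pr] := logn_primesS pm.
  exact: card_pair_order_pfactor.
- exact: stable_elts1.
by move=> a b a_gt0 b_gt0 _; apply: card_stable_eltsM.
Qed.

Lemma card_stable_swap_delta : #|stable_elts (@swap uT) m| = (totient m * delta m)%N.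
Proof.
rewrite (@multiplicative_prod_primes (fun n => #|stable_elts (@swap uT) n|)) //=.
- rewrite totient_prod delta_prod // -big_split /=; apply: eq_big_seq => p _.
  by apply: card_stable_swap; rewrite ?dvd_pf.
- exact: stable_elts1.
by move=> a b a_gt0 b_gt0 _; apply: card_stable_eltsM.
Qed.

End CyclicSquare.

(** * Diagonal matrices in GL(2, q) and conjugacy of the cyclic groups they generate *)

Section DiagonalGL2.

Import GRing.Theory.
Local Open Scope ring_scope.
Local Open Scope group_scope.
Variable F : finFieldType.
Implicit Types x y : {unit F} * {unit F}.

Definition diag2 (a b : F) : 'M[F]_2 := diag_mx (\row_(j < 2) if j == 0%R then a else b).

Lemma diag2M (a b c d : F) : (diag2 a b *m diag2 c d)%R = diag2 (a * c)%R (b * d)%R.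
Proof.
rewrite /diag2 mulmx_diag; congr diag_mx.
by apply/rowP=> j; rewrite !mxE; case: ifP.
Qed.

Lemma det_diag2 (a b : F) : (\det (diag2 a b) = a * b)%R.
Proof. by rewrite det_diag big_ord_recl big_ord1 !mxE. Qed.

Lemma tr_diag2 (a b : F) : (\tr (diag2 a b) = a + b)%R.
Proof. by rewrite mxtrace_diag big_ord_recl big_ord1 !mxE. Qed.

Lemma diag2_unit x : diag2 (val x.1) (val x.2) \in unitmx.
Proof. by rewrite unitmxE det_diag2 unitrM !(valP x.1, valP x.2). Qed.

Definition diagGL x : {'GL_2[F]} := FinRing.Unit (diag2_unit x).

Lemma diagGLM : {in setT &, {morph diagGL : x y / x * y}}.
Proof. by move=> x y _ _; apply: val_inj; rewrite /= -[RHS]/(_ *m _)%R diag2M. Qed.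

Canonical diagGL_morphism := Morphism diagGLM.

Lemma diagGL_inj : injective diagGL.
Proof.
move=> [a b] [c d] /(congr1 val)/= /matrixP E.
by congr pair; apply: val_inj; [have := E 0%R 0%R|have := E 1%R 1%R];
  rewrite !mxE.
Qed.

Lemma order_diagGL x : #[diagGL x] = #[x].
Proof.
apply: (@order_injm _ _ _ diagGL_morphism); rewrite ?inE //.
by apply/injmP=> y z _ _; apply: diagGL_inj.
Qed.

Lemma cycle_diagGL x : <[diagGL x]> = diagGL @: <[x]>.
Proof.
rewrite -(morphim_cycle diagGL_morphism) ?inE //.
by rewrite morphimEsub // subsetT.
Qed.

(** Conjugate matrices share trace and determinant, so the entries of [x] and those of [y] are the
    roots of the same quadratic. *)
Lemma diagGL_conj x (g : {'GL_2[F]}) y :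
  diagGL x ^ g = diagGL y -> y = x \/ y = swap x.
Proof.
move=> E.
have Emx : (GLval g *m diag2 (val y.1) (val y.2) = diag2 (val x.1) (val x.2) *m GLval g)%R.
  by have /(congr1 (@GLval 2 F)) := congr1 (mulg g) E; rewrite conjgE mulVKg !GL_MxE.
have Ux := GL_unitmx g.
have Ey : diag2 (val y.1) (val y.2)
    = (invmx (GLval g) *m (diag2 (val x.1) (val x.2) *m GLval g))%R.
  by rewrite -Emx mulKmx.
have tr_eq : (val y.1 + val y.2 = val x.1 + val x.2)%R.
  by rewrite -!tr_diag2 Ey mxtrace_mulC mulmxK.
have det_eq : (val y.1 * val y.2 = val x.1 * val x.2)%R.
  rewrite -!det_diag2; have /(congr1 determinant) := Emx.
  by rewrite !det_mulmx mulrC => /mulIf; apply; rewrite -unitfE -unitmxE.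
have /eqP : ((val y.1 - val x.1) * (val y.1 - val x.2) = 0)%R.
  have quad (a b c d : F) :
      ((a - c) * (a - d) = a * ((a + b) - (c + d)) + (c * d - a * b))%R.
    by ring.
  by rewrite (quad _ (val y.2)) tr_eq det_eq !subrr mulr0 addr0.
rewrite mulf_eq0 !subr_eq0 => /orP[] /eqP E1; [left|right].
  case: x y E1 tr_eq {E Emx Ey det_eq} => a b [c d] /= /val_inj-> /addrI/val_inj->.
  by [].
case: x y E1 tr_eq {E Emx Ey det_eq} => a b [c d] /= /val_inj->.
by rewrite addrC => /addIr/val_inj->.
Qed.

Lemma diagGL_swap x : exists g, diagGL x ^ g = diagGL (swap x).
Proof.
(* The permutation matrix exchanging the two basis vectors is the conjugating element. *)
have Uw : tperm_mx 0%R 1%R \in @unitmx F 2 by exact: unitmx_perm.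
exists (FinRing.Unit Uw); apply: (mulgI (FinRing.Unit Uw)).
rewrite conjgE mulVKg; apply: val_inj; rewrite /= -[LHS]/(_ *m _)%R -[RHS]/(_ *m _)%R /diag2.
apply/matrixP=> i j; rewrite mul_mx_diag mul_diag_mx !mxE permE /=.
by case: i => [[|[|i]] //= lt_i]; case: j => [[|[|j]] //= lt_j];
  rewrite -?val_eqE /= ?mulr0 ?mul0r ?mulr1 ?mul1r.
Qed.

Lemma GL2_diagonalizable (h : {'GL_2[F]}) :
  (#[h] %| #|F|.-1)%N -> exists x g, h ^ g = diagGL x.
Proof.
move=> dvd_h; have hq : h ^+ #|F|.-1 = 1 by apply/eqP; rewrite -order_dvdn.
have [|P UP] := (diagonalizableP (GLval h)).2.
  exists (enum F); first exact: enum_uniq.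
  (* The product of X - a over all a in [F] is X^q - X, which kills [h] because h^(q-1) = 1; the
     minimal polynomial therefore divides it. *)
  rewrite big_enum -finField_genPoly; apply: mxminpoly_min.
  rewrite rmorphB rmorphXn /= horner_mx_X.
  have GLX n : (GLval (h ^+ n) = GLval h ^+ n)%R by elim: n => // n IH; rewrite expgS exprS -IH.
  have q_gt0 : (0 < #|F|)%N by apply/card_gt0P; exists 0%R.
  by rewrite -GLX -(prednK q_gt0) expgS hq mulg1 subrr.
case/similar_diagPex=> d /(similarP UP) Phd.
have Ed : diag_mx d = diag2 (d 0%R 0%R) (d 0%R 1%R).
  congr diag_mx; apply/rowP=> j; rewrite mxE.
  by case: j => [[|[|j]] //= lt_j]; congr (d _ _); apply: val_inj.
have : \det (diag_mx d) \is a GRing.unit.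
  have : (\det P * \det (GLval h))%R \is a GRing.unit.
    by rewrite unitrM -!unitmxE UP GL_unitmx.
  by rewrite -det_mulmx Phd det_mulmx unitrM => /andP[].
rewrite Ed det_diag2 unitrM => /andP[U0 U1].
(* Similarity gives P h = D P, that is D = P h P^-1, whereas [h ^ g] is g^-1 h g; hence the
   inverse. *)
exists (FinRing.Unit U0, FinRing.Unit U1), (FinRing.Unit UP)^-1.
apply: (mulIg (FinRing.Unit UP)); rewrite conjgE invgK -!mulgA mulVg mulg1.
by apply: val_inj; rewrite /= -[LHS]/(_ *m _)%R -[RHS]/(_ *m _)%R Phd Ed.
Qed.

Lemma cycle_diagGL_inj x y : <[diagGL x]> = <[diagGL y]> -> <[x]> = <[y]>.
Proof. by rewrite !cycle_diagGL => /(imset_inj diagGL_inj). Qed.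

(** The first basis vector spans an invariant line. This places the diagonal cyclic groups of order
    [m] among the subgroups counted by [Ncl]. *)
Lemma reducible_cycle_diagGL x : reducibleGL <[diagGL x]>.
Proof.
apply/existsP; exists (delta_mx 0%R 0%R); rewrite mxrank_delta eqxx /=.
apply/forall_inP=> g; rewrite cycle_diagGL => /imsetP[[a b] _ ->] /=.
suff -> : (delta_mx 0%R 0%R *m diag2 (val a) (val b) = val a *: delta_mx 0%R 0%R :> 'rV_2)%R.
  exact: scalemx_sub.
apply/rowP=> j; rewrite mul_mx_diag !mxE eqxx /= mulrC.
by case: eqP; rewrite ?mulr0.
Qed.

Definition diag_class x : {set {set {'GL_2[F]}}} := <[diagGL x]> :^: [set: {'GL_2[F]}].

(** A conjugation taking one cyclic group to the other sends the generator [diagGL y] to some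
    [diagGL z] with [z] generating [<[x]>], and [diagGL_conj] leaves only [y] and [swap y] for
    [z]. *)
Lemma eq_diag_class x y :
  (diag_class x == diag_class y) = (<[x]> == <[y]>) || (<[x]> == <[swap y]>).
Proof.
apply/eqP/orP=> [E|[]/eqP E].
- have: <[diagGL x]> \in diag_class y.
    by rewrite -E; apply/imsetP; exists 1; rewrite ?inE // conjsg1.
  case/imsetP=> g _; rewrite -cycleJ => Exy.
  have : diagGL y ^ g \in <[diagGL x]> by rewrite Exy cycle_id.
  rewrite cycle_diagGL => /imsetP[z _ Ez].
  have Exz : <[x]> = <[z]> by apply: cycle_diagGL_inj; rewrite Exy Ez.
  by rewrite Exz; case: (diagGL_conj Ez) => ->; [left|right].
- by rewrite /diag_class !cycle_diagGL E.
have [g Dg] := diagGL_swap y.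
by rewrite /diag_class cycle_diagGL E -cycle_diagGL -Dg cycleJ conj_classJ.
Qed.

Lemma Ncl_diag (m : nat) : (m %| #|F|.-1)%N ->
  Ncl F m = #|diag_class @: [set x | #[x] == m]|.
Proof.
move=> dvd_m; congr #|pred_of_set _|; apply/setP=> C; apply/imsetP/imsetP.
  case=> H; rewrite inE => /and4P[_ /cyclicP[h ->] /eqP hm _ ->].
  have [|x [g hg]] := @GL2_diagonalizable h; first by rewrite orderE hm.
  exists x; first by rewrite inE -order_diagGL -hg orderJ orderE hm.
  by rewrite /diag_class -hg cycleJ conj_classJ.
case=> x; rewrite inE => /eqP xm ->; exists <[diagGL x]> => //.
by rewrite inE groupP cycle_cyclic -orderE order_diagGL xm eqxx reducible_cycle_diagGL.
Qed.

Lemma card_diag_class (m : nat) :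
  (2 * totient m * #|diag_class @: [set x | #[x] == m]|)%N
    = (#|[set x : {unit F} * {unit F} | #[x] == m]| + #|stable_elts (@swap {unit F}) m|)%N.
Proof.
pose P := [set x : {unit F} * {unit F} | #[x] == m].
transitivity (\sum_(x in P) (1 + (swap x \in <[x]>)))%N; last first.
  rewrite big_split /= sum1_card; congr addn.
  rewrite -sum1_card [RHS]big_mkcond [LHS]big_mkcond /=.
  by apply: eq_bigr => x _; rewrite !inE; case: eqP => //=; case: ifP.
rewrite (partition_big_imset diag_class) /= mulnC -sum_nat_const.
apply: eq_bigr => _ /imsetP[y yP ->]; rewrite inE in yP.
(* Over the class of y, the weight of x counts which of <x> = <y> and <x> = <swap y> hold. *)
transitivity (\sum_x (generator <[y]> x + generator <[swap y]> x))%N.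
  have sum_gen z : #[z] = m -> (\sum_x generator <[z]> x)%N = totient m.
    move=> <-; rewrite totient_gen -sum1_card [RHS]big_mkcond /=.
    by apply: eq_bigr => x _; rewrite inE; case: ifP.
  by rewrite big_split /= !sum_gen ?order_swap ?(eqP yP) // addnn mul2n.
rewrite [RHS]big_mkcond /=; apply: eq_bigr => x _.
rewrite /generator inE eq_diag_class mem_swap_cycle -(eqP yP).
rewrite [<[y]> == _]eq_sym [<[swap y]> == _]eq_sym.
(* If [<[x]> = <[y]>], the second test asks exactly whether [<[x]>] is swap-stable. If only [<[x]> =
   <[swap y]>] holds, then [<[swap x]> = <[y]>] differs from [<[x]>], so the weight is 1. *)
have [E|nE] := eqVneq <[x]> <[y]>.
  by rewrite !orderE !(cycle_swap x) E eqxx /= -cycle_swap eq_sym.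
have [E|] := eqVneq <[x]> <[swap y]>; last by rewrite andbF.
rewrite -(order_swap y) !orderE {1}E eqxx /= cycle_swap E cycle_swap -imset_comp.
rewrite (eq_imset _ (_ : _ =1 id)) => [|[]//]; rewrite imset_id -cycle_swap -E eq_sym.
by rewrite (negPf nE).
Qed.

End DiagonalGL2.

(* N(m) = (rho(m) + delta(m)) / 2, stated without division as 2 N(m) = rho + delta. *)
Theorem theoremA (F : finFieldType) (m : nat) :
  (0 < m)%N -> (m %| #|F|.-1)%N ->
  (2 * Ncl F m)%N = (rho m + delta m)%N.
Proof.
move=> m_gt0 dvd_m.
have cycU := field_unit_group_cyclic [set: {unit F}]%G.
have dvd_mU : (m %| #|[set: {unit F}]|)%N by rewrite card_finField_unit.
(* Scaling by the number of generators of a cyclic group of order [m] turns the claim on subgroups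
   into the count of elements. *)
apply/eqP; rewrite -(eqn_pmul2l (_ : 0 < totient m)%N) ?totient_gt0 //.
rewrite mulnDr -(card_pair_order cycU) // -(card_stable_swap_delta cycU) //.
by rewrite -card_diag_class -Ncl_diag // mulnA [(totient m * 2)%N]mulnC.
Qed.
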